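(* Let $G$ be a graph and let $Q$, $R$, $S$, $T$ be subsets of $V(G)$ such that $Q\cap R=S\cap T=\emptyset$. Let $\kappa_{G}(Q,R)=k$, $\kappa_{G}(S,T)=\ell$, and $F=V(G)-(Q\cup R\cup S\cup T)$. If $|F|\geq (2\ell+1)2^{2k}$, then there exists a vertex $v$ in $F$ such that at least two of the following three statements hold: (i) $\kappa_{G\setminus v}(Q,R)=k$ and $\kappa_{G\setminus v}(S,T)=\ell$. (ii) $\kappa_{G*v\setminus v}(Q,R)=k$ and $\kappa_{G*v\setminus v}(S,T)=\ell$. (iii) $\kappa_{G\wedge uv\setminus v}(Q,R)=k$ and $\kappa_{G\wedge uv\setminus v}(S,T)=\ell$ for each neighbor $u$ of $v$ in $G$.
   Context: All graphs are finite and simple (no loops or parallel edges). $G\setminus v$ denotes the graph obtained from $G$ by deleting the vertex $v$. For a vertex $v$ of $G$, $G*v$ denotes the local complementation of $G$ at $v$: the graph on the same vertex set obtained from $G$ by, for each pair $x,y$ of distinct neighbors of $v$, adding the edge $xy$ if $x,y$ are non-adjacent in $G$ and removing it otherwise. For an edge $uv$ of $G$, pivoting $uv$ gives $G\wedge uv=G*u*v*u$ (operations applied left to right; this equals $G*v*u*v$). For $X\subseteq V(G)$, the cut-rank $\rho_G(X)$ is the rank over $\mathrm{GF}(2)$ of the $X\times (V(G)-X)$ matrix whose $(i,j)$-entry is $1$ if $i$ and $j$ are adjacent in $G$ and $0$ otherwise. For disjoint $S,T\subseteq V(G)$, the connectivity between $S$ and $T$ is $\kappa_G(S,T)=\min_{S\subseteq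 X\subseteq V(G)-T}\rho_G(X)$. *)

(* Defs.v *)
From mathcomp Require Import all_boot all_order all_algebra.
Set Implicit Arguments.
Unset Strict Implicit.
Unset Printing Implicit Defensive.

(** The vertex set is a subset of an ambient finite type, so that the subsets
    [Q], [R], [S], [T] of [V(G)] remain vertex sets of the graph after a vertex
    outside of them is deleted, without transport to a subtype. *)
Record sgraph (W : finType) := SGraph {
  vset : {set W};
  adj : rel W;
  adj_sym : symmetric adj;
  adj_irr : irreflexive adj;
  adj_vset : forall x y, adj x y -> x \in vset
}.

Section Operations.
Variables (W : finType) (G : sgraph W).
Implicit Types (u v x y : W) (X S T : {set W}).

Definition delete_adj v : rel W :=
  fun x y => [&& x != v, y != v & adj G x y].

Lemma delete_sym v : symmetric (delete_adj v).
Proof. by move=> x y; rewrite /delete_adj adj_sym andbCA. Qed.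

Lemma delete_irr v : irreflexive (delete_adj v).
Proof. by move=> x; rewrite /delete_adj adj_irr !andbF. Qed.

Lemma delete_vset v x y : delete_adj v x y -> x \in vset G :\ v.
Proof. by case/and3P=> xv _ /adj_vset xG; rewrite !inE xv. Qed.

Definition delete v : sgraph W :=
  SGraph (@delete_sym v) (@delete_irr v) (@delete_vset v).

Definition local_compl_adj v : rel W :=
  fun x y => adj G x y (+) [&& x != y, adj G v x & adj G v y].

Lemma local_compl_sym v : symmetric (local_compl_adj v).
Proof.
by move=> x y; rewrite /local_compl_adj adj_sym eq_sym [adj G v x && _]andbC.
Qed.

Lemma local_compl_irr v : irreflexive (local_compl_adj v).
Proof. by move=> x; rewrite /local_compl_adj adj_irr eqxx. Qed.

Lemma local_compl_vset v x y : local_compl_adj v x y -> x \in vset G.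
Proof.
rewrite /local_compl_adj; case xy: (adj G x y) => /=.
  by move=> _; apply: adj_vset xy.
by case/and3P=> _ + _; rewrite adj_sym; apply: adj_vset.
Qed.

Definition local_compl v : sgraph W :=
  SGraph (@local_compl_sym v) (@local_compl_irr v) (@local_compl_vset v).

Definition cutrank X : nat :=
  \rank (\matrix_(i < #|X|, j < #|vset G :\: X|)
           (adj G (enum_val i) (enum_val j))%:R : 'M['F_2]_(_, _))%R.

(** For disjoint [S], [T] included in [V(G)], the set [S] itself is admissible,
    so the [arg min] is over a nonempty family; otherwise the value is junk. *)
Definition connectivity S T : nat :=
  cutrank [arg min_(X < S | (S \subset X) && (X \subset vset G :\: T))
             cutrank X].

End Operations.

(** Meaningful when [u] and [v] are adjacent in [G]. *)
Definition pivot (W : finType) (G : sgraph W) (u v : W) : sgraph W :=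
  local_compl (local_compl (local_compl G u) v) u.

Definition at_least_two (A B C : Prop) : Prop :=
  (A /\ B) \/ (A /\ C) \/ (B /\ C).

(* Main.v *)
Require Import Defs.
From HB Require Import structures.
From mathcomp Require Import all_boot all_order all_algebra zify.
Set Implicit Arguments.
Unset Strict Implicit.
Unset Printing Implicit Defensive.
Import GRing.Theory.

(** Each vector [x] over the two-element field is seen together with its image [A x] under the
    adjacency matrix, so that it has an entry [(x_w, (A x)_w)] in a symplectic plane at every
    vertex [w]. The vectors whose entries vanish off [X] form a space of dimension
    [|X| - cutrank X], the three ways of removing [v] correspond to the three nonzero elements
    [t] of the plane, and any two vectors are orthogonal for the sum of the symplectic forms.

    If removing [v] in the way [t] lowers the connectivity of [(Q, R)], call [t] bad for [(Q, R)]
    at [v]; at most one [t] is. If the theorem fails, every [v] in [F] has a bad [a v] for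
    [(Q, R)] and a different bad [b v] for [(S, T)]. Choosing types other than [b] on [F] so that
    restricting to them keeps the connectivity of [(Q, R)], every [v] in [F] carries a vector
    with entry [a v] at [v] and entries of the chosen types elsewhere. These vectors fall into at
    most [2 ^ (2 * k)] classes modulo vectors supported on either side of a minimum cut. Differences
    within a class span a locally isotropic space avoiding [b] on [F], whose dimension on [F] is at
    most [l] by the minimality of the [(S, T)] cuts. Hence [|F| <= (l + 1) * 2 ^ (2 * k)], and
    [l > 0], contradicting the hypothesis. *)

(** * The symplectic plane over the two-element field *)

Section SymplecticPlane.
Local Open Scope ring_scope.

Definition plane : vectType 'F_2 := (('F_2)^o * ('F_2)^o)%type.

Lemma F2P (x : 'F_2) : x = 0 \/ x = 1.
Proof.
case: x => -[|[|n]] // lt_n; first by left; apply: val_inj.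
by right; apply: val_inj.
Qed.

Lemma F2_addxx (x : 'F_2) : x + x = 0.
Proof. by case: (F2P x) => ->; apply: val_inj. Qed.

Definition sp (s t : plane) : ('F_2)^o := s.1 * t.2 + s.2 * t.1.

Fact sp_is_linear s : linear (sp s).
Proof.
move=> a t t'; rewrite /sp /= !mulrDr /GRing.scale /= addrACA.
by congr (_ + _); rewrite mulrDr mulrCA [X in _ + X = _]mulrCA.
Qed.
HB.instance Definition _ s := GRing.isLinear.Build _ _ _ _ (sp s) (sp_is_linear s).

Lemma spC s t : sp s t = sp t s.
Proof. by rewrite /sp addrC mulrC [X in _ + X = _]mulrC. Qed.

Lemma spDr s t u : sp s (t + u) = sp s t + sp s u.
Proof. exact: raddfD. Qed.

Lemma spDl s t u : sp (s + t) u = sp s u + sp t u.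
Proof. by rewrite spC spDr !(spC u). Qed.

Lemma spxx s : sp s s = 0.
Proof. by rewrite /sp mulrC F2_addxx. Qed.

(** The orthogonal of a nonzero [s] is the line of [s], whose only nonzero element is [s]. *)
Lemma sp_eq0 s t : s != 0 -> t != 0 -> sp s t = 0 -> s = t.
Proof.
case: s t => [a b] [c d]; rewrite /sp /=.
case: (F2P a) => ->; case: (F2P b) => ->; case: (F2P c) => ->;
  by case: (F2P d) => -> //.
Qed.

Lemma sp_line t x : t != 0 -> sp t x = 0 -> x = 0 \/ x = t.
Proof.
by move=> t0 tx; case: (eqVneq x 0) => [|x0]; [left | right; rewrite (sp_eq0 t0 x0 tx)].
Qed.

Lemma sp_isotropic t x y : t != 0 -> sp t x = 0 -> sp t y = 0 -> sp x y = 0.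
Proof.
by move=> t0 /(sp_line t0)[->|-> //] _; rewrite spC raddf0.
Qed.

Lemma sp_sep s t x : s != 0 -> t != 0 -> s != t -> sp s x = 0 -> sp t x = 0 -> x = 0.
Proof.
move=> s0 t0 st sx tx; apply/eqP; apply: contraNT st => x0.
by rewrite (sp_eq0 s0 x0 sx) (sp_eq0 t0 x0 tx).
Qed.
End SymplecticPlane.

(** * Rank and nullity *)

Section RowKernel.
Local Open Scope ring_scope.

(** In the factorization of [M] through its rank, [row_base M] is injective on rows and [col_base M]
    is onto, so the first factor alone carries the kernel. *)
Lemma dim_lker_mulmxr (K : fieldType) m n (M : 'M[K]_(m, n)) :
  (\dim (lker (linfun (mulmxr M : 'rV_m -> 'rV_n))) + \rank M = m)%N.
Proof.
have dim_row p : dim 'rV[K]_p = p by exact: mul1n.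
set f := linfun _; set g := linfun (mulmxr (col_base M) : 'rV_m -> 'rV_(\rank M)).
have -> : lker f = lker g.
  apply/vspaceP => x; rewrite !memv_ker !lfunE /= -{1}(mulmx_base M) mulmxA.
  by rewrite mulmx_free_eq0 // row_base_free.
have := limg_ker_dim g fullv; rewrite capfv dimvf dim_row.
suff -> : limg g = fullv by rewrite dimvf dim_row.
apply/vspaceP => y; rewrite memvf; apply/memv_imgP.
have /row_fullP[B BC] : row_full (col_base M) by rewrite col_base_full.
by exists (y *m B); rewrite ?memvf // lfunE /= -mulmxA BC mulmx1.
Qed.

Lemma dim_cap_lker (K : fieldType) (vT : vectType K) (U : {vspace vT}) (f : 'Hom(vT, K^o)) :
  (\dim U <= (\dim (U :&: lker f)).+1)%N.
Proof.
rewrite -(limg_ker_dim f U) -[leqRHS]addn1 leq_add2l.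
by apply: leq_trans (dimvS (subvf _)) _; rewrite dimvf.
Qed.
End RowKernel.

(** * Types different from a given one *)

Section OtherTypes.
Local Open Scope ring_scope.

(** For nonzero [t], [other1 t] and [other2 t] are the two remaining nonzero elements; at [t = 0]
    they are still nonzero and distinct. *)
Definition other1 (t : plane) : plane := if t == (1, 0) then (0, 1) else (1, 0).
Definition other2 (t : plane) : plane := if t == (1, 1) then (0, 1) else (1, 1).

Lemma other_types t :
  [/\ other1 t != 0, other2 t != 0, other1 t != other2 t, other1 t != t & other2 t != t].
Proof.
case: t => a b; rewrite /other1 /other2.
by case: (F2P a) => ->; case: (F2P b) => ->.
Qed.
End OtherTypes.

(** * Vectors, their entries and their supports *)

Section GraphVectors.
Local Open Scope ring_scope.
Variables (W : finType).
Implicit Types (G H : sgraph W) (X Y : {set W}) (u v w : W).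

Definition vecs : vectType 'F_2 := {ffun W -> ('F_2)^o}.

Definition nbsum G (x : vecs) w : ('F_2)^o := \sum_u x u * (adj G u w)%:R.

Definition entry G w (x : vecs) : plane := (x w, nbsum G x w).

Fact entry_is_linear G w : linear (entry G w).
Proof.
move=> a x y; congr (_, _); rewrite /= ?ffunE //.
rewrite /nbsum scaler_sumr -big_split; apply: eq_bigr => u _.
by rewrite !ffunE mulrDl -scalerAl.
Qed.
HB.instance Definition _ G w := GRing.isLinear.Build _ _ _ _ (entry G w) (entry_is_linear G w).

(* The subspaces below are projected from opaque proofs, as failing unifications would otherwise
   unfold them down to matrices. *)
Fact entry_ker_subproof G w :
  {U : {vspace vecs} | forall x, (x \in U) = (entry G w x == 0)}.
Proof. by exists (lker (linfun (entry G w))) => x; rewrite memv_ker lfunE. Qed.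

Definition entry_ker G w := sval (entry_ker_subproof G w).

Lemma memv_entry_ker G w x : (x \in entry_ker G w) = (entry G w x == 0).
Proof. exact: (svalP (entry_ker_subproof G w)). Qed.

Let typef G t w : 'Hom(vecs, ('F_2)^o) := (linfun (sp t) \o linfun (entry G w))%VF.

Let memv_typef G t w x : (x \in lker (typef G t w)) = (sp t (entry G w x) == 0).
Proof. by rewrite memv_ker comp_lfunE !lfunE. Qed.

Fact type_ker_subproof G t w :
  {U : {vspace vecs} | forall x, (x \in U) = (sp t (entry G w x) == 0)}.
Proof. by exists (lker (typef G t w)) => x; exact: memv_typef. Qed.

Definition type_ker G t w := sval (type_ker_subproof G t w).

Lemma memv_type_ker G t w x : (x \in type_ker G t w) = (sp t (entry G w x) == 0).
Proof. exact: (svalP (type_ker_subproof G t w)). Qed.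

Lemma dim_cap_type_ker G t w (U : {vspace vecs}) :
  (\dim U <= (\dim (U :&: type_ker G t w)).+1)%N.
Proof.
suff -> : type_ker G t w = lker (typef G t w) by apply: dim_cap_lker.
by apply/vspaceP => x; rewrite memv_typef memv_type_ker.
Qed.

Let memv_capP (P : pred W) (U : W -> {vspace vecs}) x :
  (x \in (\bigcap_(w | P w) U w)%VS) = [forall (w | P w), x \in U w].
Proof. by apply/subv_bigcapP/forall_inP. Qed.

Fact supp_space_subproof G X : {U : {vspace vecs} |
  forall x, (x \in U) = [forall (w | w \notin X), x \in entry_ker G w]}.
Proof. by exists (\bigcap_(w | w \notin X) entry_ker G w)%VS; exact: memv_capP. Qed.

Definition supp_space G X := sval (supp_space_subproof G X).

Lemma supp_spaceP G X x :
  reflect (forall w, w \notin X -> entry G w x = 0) (x \in supp_space G X).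
Proof.
rewrite (svalP (supp_space_subproof G X)); apply: (iffP forall_inP) => h w /h.
  by rewrite memv_entry_ker => /eqP.
by move=> e; rewrite memv_entry_ker e.
Qed.

Fact type_space_subproof G X (t : W -> plane) : {U : {vspace vecs} |
  forall x, (x \in U) = [forall (w | w \in X), x \in type_ker G (t w) w]}.
Proof. by exists (\bigcap_(w | w \in X) type_ker G (t w) w)%VS; exact: memv_capP. Qed.

Definition type_space G X t := sval (type_space_subproof G X t).

Lemma type_spaceP G X t x :
  reflect (forall w, w \in X -> sp (t w) (entry G w x) = 0) (x \in type_space G X t).
Proof.
rewrite (svalP (type_space_subproof G X t)); apply: (iffP forall_inP) => h w /h.
  by rewrite memv_type_ker => /eqP.
by move=> e; rewrite memv_type_ker e.
Qed.

Lemma supp_spaceS G X Y : X \subset Y -> (supp_space G X <= supp_space G Y)%VS.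
Proof.
move=> XY; apply/subvP => x /supp_spaceP h; apply/supp_spaceP => w wY.
by apply: h; apply: contra wY => /(subsetP XY).
Qed.

Lemma supp_spaceI G X Y :
  (supp_space G X :&: supp_space G Y)%VS = supp_space G (X :&: Y).
Proof.
apply/vspaceP => x; rewrite memv_cap; apply/andP/idP => [[/supp_spaceP hX /supp_spaceP hY]|].
  by apply/supp_spaceP => w; rewrite inE negb_and => /orP[/hX|/hY].
by move=> h; split; apply: subvP x h; apply: supp_spaceS; rewrite (subsetIl, subsetIr).
Qed.

Lemma supp_space0 G : supp_space G set0 = 0%VS.
Proof.
apply/eqP; rewrite -subv0; apply/subvP => x /supp_spaceP h; rewrite memv0.
apply/eqP/ffunP => w; rewrite ffunE.
by have [] := h w (negbT (in_set0 w)).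
Qed.

(* In characteristic two the sum is [2 x A y^T], by symmetry of the adjacency matrix [A]. *)
Lemma sum_sp_entry G x y : \sum_w sp (entry G w x) (entry G w y) = 0.
Proof.
rewrite /sp /= big_split /=.
have -> : \sum_w nbsum G x w * y w = \sum_w x w * nbsum G y w.
  under eq_bigr do rewrite mulr_suml; rewrite exchange_big /=.
  apply: eq_bigr => u _; rewrite mulr_sumr; apply: eq_bigr => w _.
  by rewrite -mulrA [_ * y w]mulrC adj_sym.
exact: F2_addxx.
Qed.

Definition cut_mx G X Y : 'M['F_2]_(#|X|, #|Y|) :=
  \matrix_(i, j) (adj G (enum_val i) (enum_val j))%:R.

Lemma cutrankE G X : cutrank G X = \rank (cut_mx G X (vset G :\: X)).
Proof. by []. Qed.

Lemma cutrankC G X : X \subset vset G -> cutrank G (vset G :\: X) = cutrank G X.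
Proof.
move=> XV; rewrite !cutrankE setDDr setDv set0U (setIidPr XV) -mxrank_tr.
by congr (\rank _); apply/matrixP => i j; rewrite !mxE adj_sym.
Qed.

(** A vector vanishing off [X] is a row indexed by [X]; its neighbour sums vanish on [vset G :\: X]
    exactly when this row lies in the left kernel of the cut matrix, and outside [vset G] they
    always vanish. *)
Lemma dim_supp_space G X : X \subset vset G ->
  (cutrank G X + \dim (supp_space G X) = #|X|)%N.
Proof.
move=> XV; rewrite cutrankE; set M := cut_mx _ _ _.
pose ext (r : 'rV['F_2]_#|X|) : vecs := [ffun w => \sum_i r 0 i *+ (enum_val i == w)].
have ext_lin : linear ext.
  move=> a r s; apply/ffunP => w; rewrite !ffunE scaler_sumr -big_split.
  by apply: eq_bigr => i _; rewrite !mxE mulrnDl -mulrnAr.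
pose extL : {linear 'rV['F_2]_#|X| -> vecs} :=
  HB.pack ext (GRing.isLinear.Build _ _ _ _ ext ext_lin).
pose f := linfun extL.
have extE r i : f r (enum_val i) = r 0 i.
  rewrite lfunE ffunE (bigD1 i) //= eqxx big1 ?addr0 // => j ji.
  by rewrite (inj_eq enum_val_inj) (negbTE ji).
have ext0 r w : w \notin X -> f r w = 0.
  move=> wX; rewrite lfunE ffunE big1 // => i _; case: eqP => // e.
  by rewrite -e enum_valP in wX.
have nbE r (w : W) : nbsum G (f r) w = \sum_i r 0 i * (adj G (enum_val i) w)%:R.
  rewrite /nbsum (bigID (mem X)) /= [X in _ + X]big1 ?addr0.
    rewrite big_enum_val /=.
    by apply: eq_bigr => i _; rewrite extE.
  by move=> u uX; rewrite ext0 // mul0r.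
pose g := linfun (mulmxr M : 'rV_#|X| -> 'rV_#|vset G :\: X|).
suff -> : supp_space G X = (f @: lker g)%VS.
  rewrite limg_dim_eq; first by rewrite addnC dim_lker_mulmxr.
  apply/eqP; rewrite -subv0; apply/subvP => r; rewrite memv_cap memv0 => /andP[_].
  rewrite memv_ker => /eqP fr0; apply/eqP/rowP => i.
  by rewrite -extE fr0 !mxE ffunE.
apply/vspaceP => x; apply/supp_spaceP/memv_imgP => [h|[r]].
  have xE : x = f (\row_i x (enum_val i)).
    apply/ffunP => w; have [wX|wX] := boolP (w \in X); last first.
      by rewrite ext0 //; have [] := h w wX.
    by rewrite -(enum_rankK_in wX wX) extE mxE.
  exists (\row_i x (enum_val i)) => //; rewrite memv_ker lfunE; apply/eqP/rowP => j.
  rewrite !mxE; have := enum_valP j; rewrite inE => /andP[jX _].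
  have [_] := h _ jX; rewrite {1}xE nbE => e; rewrite -[RHS]e.
  by apply: eq_bigr => i _; rewrite !mxE.
rewrite memv_ker lfunE => /eqP rM -> w wX; congr (_, _); first exact: ext0.
rewrite nbE; have [wV|wV] := boolP (w \in vset G); last first.
  rewrite big1 // => i _; rewrite adj_sym.
  by case: (boolP (adj G w _)) => [/adj_vset wG|]; rewrite ?mulr0 // wG in wV *.
have wVX : w \in vset G :\: X by rewrite inE wX.
have /rowP/(_ (enum_rank_in wVX w)) := rM; rewrite !mxE => e; rewrite -[RHS]e.
by apply: eq_bigr => i _; rewrite !mxE enum_rankK_in.
Qed.

End GraphVectors.

(** * Local complementation, pivoting and deletion acting on vectors *)

Section Minors.
Local Open Scope ring_scope.
Variables (W : finType).
Implicit Types (G H : sgraph W) (X Y : {set W}) (u v w : W).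

Local Notation vecs := (vecs W).

(** The change of coordinates matching [G] with its local complement at [v]: it acts on each entry
    by an invertible map, so supports are preserved. *)
Definition lc_fun G v (x : vecs) : vecs :=
  [ffun w => x w + (w == v)%:R * nbsum G x v].

Fact lc_fun_is_linear G v : linear (lc_fun G v).
Proof.
move=> a x y; have [_ nbD] := entry_is_linear G v a x y.
by apply/ffunP => w; rewrite !ffunE nbD mulrDr scalerDr -scalerAr addrACA.
Qed.
HB.instance Definition _ G v :=
  GRing.isLinear.Build _ _ _ _ (lc_fun G v) (lc_fun_is_linear G v).

Definition lc_map G v : 'End(vecs) := linfun (lc_fun G v).

(** At a neighbour [w] of [v], complementing adds [nbsum G x v] without the term [x w], and the new
    coordinate at [v] adds [nbsum G x v] again; only [x w] survives. *)
Lemma entry_lc_map G v w x :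
  entry (local_compl G v) w (lc_map G v x) =
  (x w + (w == v)%:R * nbsum G x v, nbsum G x w + (adj G v w)%:R * x w).
Proof.
rewrite /entry lfunE /=; congr (_, _); first by rewrite ffunE.
have bE (b c : bool) : (b (+) c)%:R = b%:R + c%:R :> 'F_2.
  by case: b c => [] []; apply: val_inj.
rewrite /nbsum; under eq_bigr => u _ do rewrite ffunE mulrDl /= /local_compl_adj bE !mulrDr.
rewrite big_split /= 2!big_split /= -addrA; congr (_ + _).
rewrite [X in _ + (X + _)](bigD1 v) //= [X in _ + (_ + X + _)]big1 ?addr0; last first.
  by move=> u /negbTE->; rewrite !mul0r.
rewrite [X in _ + (_ + X)](bigD1 v) //= adj_irr andbF mulr0 add0r.
rewrite [X in _ + (_ + X)]big1 ?addr0; last by move=> u /negbTE->; rewrite !mul0r.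
rewrite eqxx mul1r.
case vw: (adj G v w); last first.
  rewrite mulr0 mul0r addr0 big1 // => u _.
  by rewrite !andbF mulr0.
rewrite mulr1 mul1r /nbsum -big_split (bigD1 w) //= eqxx mulr0 add0r.
rewrite big1 ?addr0 => [|u uw]; first by rewrite adj_sym vw mulr1.
by rewrite uw andbT /= [adj G u v]adj_sym F2_addxx.
Qed.

Lemma entry_lc_map_eq0 G v w x :
  (entry (local_compl G v) w (lc_map G v x) == 0) = (entry G w x == 0).
Proof.
have pE (a b : ('F_2)^o) : ((a, b) == 0 :> plane) = (a == 0) && (b == 0) by [].
rewrite entry_lc_map /entry !pE; have [->|wv] := eqVneq w v.
  rewrite adj_irr mul1r mul0r addr0; have [->|] := eqVneq (nbsum G x v) 0; first by rewrite addr0.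
  by rewrite !andbF.
rewrite mul0r addr0; have [->|//] := eqVneq (x w) 0.
by rewrite mulr0 addr0.
Qed.

Lemma lker_lc_map G v : lker (lc_map G v) == 0%VS.
Proof.
rewrite -subv0; apply/subvP => x; rewrite memv_ker => /eqP x0.
rewrite -(supp_space0 G); apply/supp_spaceP => w _; apply/eqP.
by rewrite -(entry_lc_map_eq0 _ v) x0 raddf0.
Qed.

Lemma entry_delete G v w (x : vecs) :
  x v = 0 -> entry (delete G v) w x = (x w, (w != v)%:R * nbsum G x w).
Proof.
move=> xv; congr (_, _); rewrite /nbsum mulr_sumr; apply: eq_bigr => u _.
rewrite /= /delete_adj; case: (eqVneq u v) => [->|uv].
  by rewrite xv !mul0r mulr0.
by case: eqP; rewrite ?mul1r ?mul0r ?mulr0.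
Qed.

(* Given [X], the vectors counted here play for [H] the role that [supp_space G X] plays for [G]. *)
Definition is_minor_of_type G H v (t : plane) :=
  vset H = vset G :\ v /\
  forall X, X \subset vset G :\ v ->
    (cutrank H X + \dim (supp_space G (v |: X) :&: type_ker G t v) = #|X|)%N.

(** [f] turns the type condition at [v] into a zero coordinate at [v]. On such vectors, deleting [v]
    only forgets the neighbour sum at [v], so the counted space is carried onto
    [supp_space (delete H v) X]. *)
Lemma minor_of_iso G H v t (f : 'End(vecs)) :
    vset H = vset G -> lker f == 0%VS ->
    (forall w x, (entry H w (f x) == 0) = (entry G w x == 0)) ->
    (forall x, (f x) v = sp t (entry G v x)) ->
  is_minor_of_type G (delete H v) v t.
Proof.
move=> HG finj f0 ft; split=> [|X XV]; first by rewrite /= HG.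
have -> : #|X| = (cutrank (delete H v) X + \dim (supp_space (delete H v) X))%N.
  by rewrite dim_supp_space //= HG.
congr (_ + _)%N.
have vX : v \notin X by apply/negP => /(subsetP XV); rewrite !inE eqxx.
rewrite -(@limg_dim_eq _ _ _ f); last by rewrite (eqP finj) capv0.
congr (\dim _); apply/vspaceP => y; apply/memv_imgP/supp_spaceP => [[x]|h].
  rewrite memv_cap memv_type_ker => /andP[/supp_spaceP sx /eqP tx] -> w wX.
  have fxv : f x v = 0 by rewrite ft tx.
  rewrite entry_delete //; case: (eqVneq w v) => [->|wv]; first by rewrite fxv mul0r.
  have /eqP : entry G w x = 0 by apply: sx; rewrite !inE negb_or wv.
  by rewrite -f0 mul1r => /eqP.
have yv : y v = 0 by have [] := h v vX.
have yE : y = f (f^-1%VF y) by rewrite lker0_lfunVK.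
exists (f^-1%VF y) => //; rewrite memv_cap memv_type_ker; apply/andP; split; last first.
  by rewrite -ft -yE yv.
apply/supp_spaceP => w; rewrite !inE negb_or => /andP[wv wX]; apply/eqP.
rewrite -f0 -yE; apply/eqP; have := h w wX.
by rewrite entry_delete // wv mul1r.
Qed.

Lemma minor_delete G v : is_minor_of_type G (delete G v) v (0, 1).
Proof.
apply: (@minor_of_iso _ _ _ _ \1%VF) => // [|w x|x].
- by apply/lker0P => x y; rewrite !lfunE.
- by rewrite lfunE.
by rewrite lfunE /sp /= mul0r add0r mul1r.
Qed.

Lemma minor_local_compl G v :
  is_minor_of_type G (delete (local_compl G v) v) v (1, 1).
Proof.
apply: (@minor_of_iso _ _ _ _ (lc_map G v)) => // [|w x|x].
- exact: lker_lc_map.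
- exact: entry_lc_map_eq0.
by rewrite lfunE ffunE eqxx /sp /= !mul1r addrC.
Qed.

Lemma minor_pivot G u v : adj G v u -> is_minor_of_type G (delete (pivot G u v) v) v (1, 0).
Proof.
move=> vu; set G1 := local_compl G u; set G2 := local_compl G1 v.
apply: (@minor_of_iso _ _ _ _ (lc_map G2 u \o (lc_map G1 v \o lc_map G u))%VF) => // [|w x|x].
- have inj H w : injective (lc_map H w) by apply/lker0P/lker_lc_map.
  by apply/lker0P => x y; rewrite !comp_lfunE => /inj/inj/inj.
- by rewrite !comp_lfunE !entry_lc_map_eq0.
have uv : (v == u) = false by apply/eqP => e; rewrite e adj_irr in vu.
rewrite !comp_lfunE; set y := lc_map G u x; set z := lc_map G1 v y.
(* Let [(p, n)] be the original entry at [v]. The first map changes it to [(p, n + p)], the second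
   changes its coordinate to [p + (n + p) = n], and the third keeps that coordinate. *)
have [yv nyv] := entry_lc_map G u v x.
have [zv nzv] := entry_lc_map G1 v v y.
have [-> _] := entry_lc_map G2 u v z.
rewrite uv mul0r addr0 zv eqxx mul1r yv nyv uv adj_sym vu mul0r addr0 mul1r.
by rewrite addrCA F2_addxx addr0 /sp /= mul1r mul0r addr0.
Qed.
End Minors.

(** * Connectivity as an attained minimum *)

Section Connectivity.
Variable W : finType.

Lemma connectivity_le (G : sgraph W) (Q R X : {set W}) :
  Q \subset X -> X \subset vset G :\: R -> connectivity G Q R <= cutrank G X.
Proof.
move=> QX XR; rewrite /connectivity; case: arg_minnP => [|Y _ ->] //; last by rewrite QX.
by rewrite subxx (subset_trans QX).
Qed.

Lemma connectivity_attained (G : sgraph W) (Q R : {set W}) : Q \subset vset G :\: R ->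
  exists X : {set W}, [/\ Q \subset X, X \subset vset G :\: R & cutrank G X = connectivity G Q R].
Proof.
move=> QR; rewrite /connectivity; case: arg_minnP => [|Y /andP[QY YR] _]; last by exists Y.
by rewrite subxx.
Qed.

End Connectivity.

(** * Minimum cuts ([tight] sets), their uncrossing, and bad types *)

Section Tight.
Variables (W : finType) (G : sgraph W).
Implicit Types (X Y A B Q R : {set W}) (u v w : W) (t : plane).
Local Notation V := (vset G).
Local Notation LX := (supp_space G).

(** The supported spaces of [X] and [Y] meet in that of [X :&: Y], and their sum lies in that of
    [X :|: Y]. *)
Lemma cutrank_submod X Y : X \subset V -> Y \subset V ->
  cutrank G (X :&: Y) + cutrank G (X :|: Y) <= cutrank G X + cutrank G Y.
Proof.
move=> XV YV; have UV : X :|: Y \subset V by rewrite subUset XV.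
have IV : X :&: Y \subset V by rewrite subIset ?XV.
have := dim_supp_space XV; have := dim_supp_space YV.
have := dim_supp_space UV; have := dim_supp_space IV.
have := cardsUI X Y; have := dimv_sum_cap (LX X) (LX Y).
have : \dim (LX X + LX Y) <= \dim (LX (X :|: Y)).
  by apply: dimvS; rewrite subv_add !supp_spaceS ?subsetUl ?subsetUr.
by rewrite supp_spaceI; lia.
Qed.

Lemma supp_spaceU1 v X x : x \in LX (v |: X) -> entry G v x = 0%R -> x \in LX X.
Proof.
move=> /supp_spaceP sx xv; apply/supp_spaceP => w wX; have [->//|wv] := eqVneq w v.
by apply: sx; rewrite !inE negb_or wv.
Qed.

(** The set grows and its cut-rank does not, so the supported space gains a vector, which cannot
    vanish at [v]. *)
Lemma supp_jump v X : v \in V -> v \notin X -> X \subset V ->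
  cutrank G (v |: X) <= cutrank G X -> exists2 x, x \in LX (v |: X) & entry G v x != 0%R.
Proof.
move=> vV vX XV le_rk; have XvV : v |: X \subset V by rewrite subUset sub1set vV.
have /subvPn[x xX xnX] : ~~ (LX (v |: X) <= LX X)%VS.
  apply/negP => /dimvS; have := dim_supp_space XV; have := dim_supp_space XvV.
  by rewrite cardsU1 vX; lia.
exists x => //; apply: contra xnX => /eqP xv; exact: supp_spaceU1 xX xv.
Qed.

(** In the global orthogonality relation every term except the one at [v] has a zero factor. *)
Lemma sp_single v A B x y : x \in LX A -> y \in LX B ->
  A :&: B \subset [set v] -> sp (entry G v x) (entry G v y) = 0%R.
Proof.
move=> /supp_spaceP sx /supp_spaceP sy /subsetP AB.
have := sum_sp_entry G x y; rewrite (bigD1 v) //= big1 ?addr0 // => w wv.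
have : w \notin A :&: B by apply: contra wv => /AB; rewrite inE.
by rewrite inE negb_and => /orP[/sx->|/sy->]; rewrite ?raddf0 // spC raddf0.
Qed.

Definition tight Q R X :=
  [&& Q \subset X, X \subset V :\: R & cutrank G X == connectivity G Q R].

Lemma tight_subV Q R X : tight Q R X -> X \subset V.
Proof. by case/and3P=> _ XR _; apply: subset_trans XR (subsetDl _ _). Qed.

Lemma tight_rank Q R X : tight Q R X -> cutrank G X = connectivity G Q R.
Proof. by case/and3P=> _ _ /eqP. Qed.

Lemma tightUI Q R X Y : tight Q R X -> tight Q R Y ->
  tight Q R (X :&: Y) /\ tight Q R (X :|: Y).
Proof.
move=> tX tY; have := cutrank_submod (tight_subV tX) (tight_subV tY).
case/and3P: tX => QX XR /eqP eX; case/and3P: tY => QY YR /eqP eY.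
have QI : Q \subset X :&: Y by rewrite subsetI QX.
have IR : X :&: Y \subset V :\: R by rewrite subIset ?XR.
have QU : Q \subset X :|: Y by rewrite (subset_trans QX) ?subsetUl.
have UR : X :|: Y \subset V :\: R by rewrite subUset XR.
have := connectivity_le QI IR; have := connectivity_le QU UR.
rewrite /tight QI IR QU UR eX eY /=; lia.
Qed.

Lemma tightI Q R X Y : tight Q R X -> tight Q R Y -> tight Q R (X :&: Y).
Proof. by move=> tX tY; have [] := tightUI tX tY. Qed.

Lemma tightU Q R X Y : tight Q R X -> tight Q R Y -> tight Q R (X :|: Y).
Proof. by move=> tX tY; have [] := tightUI tX tY. Qed.

Definition tight_pair Q R v A := [&& v \notin A, tight Q R A & tight Q R (v |: A)].

Lemma tight_pair_inV Q R v A : tight_pair Q R v A -> v \in V.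
Proof. by case/and3P=> _ _ /tight_subV/subsetP; apply; rewrite setU11. Qed.

Lemma tight_pairI Q R v A B : tight_pair Q R v A -> tight Q R B -> 
  v \in B -> tight_pair Q R v (A :&: B).
Proof.
case/and3P=> vA tA tvA tB vB; rewrite /tight_pair inE (negbTE vA) /= tightI //=.
suff -> : v |: A :&: B = (v |: A) :&: B by rewrite tightI.
by apply/setP => w; rewrite !inE; case: eqP => // ->.
Qed.

Lemma tight_pairU Q R v A B : tight_pair Q R v A -> tight Q R B -> 
  v \notin B -> tight_pair Q R v (A :|: B).
Proof.
case/and3P=> vA tA tvA tB vB.
by rewrite /tight_pair inE negb_or vA vB tightU //= setUA tightU.
Qed.

Lemma tight_pair_jump Q R v A : tight_pair Q R v A ->
  exists2 x, x \in LX (v |: A) & entry G v x != 0%R.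
Proof.
move=> p; have vV := tight_pair_inV p; case/and3P: p => vA tA tvA.
by apply: supp_jump (tight_subV tA) _ => //; rewrite (tight_rank tA) (tight_rank tvA).
Qed.

Lemma setD_U1 v A : v \in V -> v \notin A -> v |: (V :\: (v |: A)) = V :\: A.
Proof.
by move=> vV vA; apply/setP => w; rewrite !inE; case: eqP => // ->; rewrite vV vA.
Qed.

Lemma tight_pair_jumpC Q R v A : tight_pair Q R v A ->
  exists2 x, x \in LX (V :\: A) & entry G v x != 0%R.
Proof.
move=> p; have vV := tight_pair_inV p; case/and3P: p => vA tA tvA.
rewrite -(setD_U1 vV vA); apply: supp_jump => //; rewrite ?subsetDl //.
  by rewrite !inE eqxx.
rewrite setD_U1 // !cutrankC ?(tight_subV tA) ?(tight_subV tvA) //.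
by rewrite (tight_rank tA) (tight_rank tvA).
Qed.

(** The trace left in [G] by a drop of connectivity when [v] is removed in the way [t], as shown by
    [bad_type_minor]: one vector on each side of a pair of minimum cuts. *)
Definition bad_type Q R v t := t != 0%R /\ exists A, tight_pair Q R v A /\
  (exists2 x, x \in LX (v |: A) & entry G v x = t) /\
  (exists2 y, y \in LX (V :\: A) & entry G v y = t).

(** Let [B] certify [t]. The pair given by [A :|: B] has an outer vector [c] nonzero at [v];
    orthogonality to the inner vector of [B] makes its entry [t], and orthogonality to [x]
    concludes. *)
Lemma bad_type_inside Q R v t A x : bad_type Q R v t -> tight_pair Q R v A ->
  x \in LX (v |: A) -> sp t (entry G v x) = 0%R.
Proof.
case=> t0 [B [pB [[b bB bt] _]]] pA xA.
have tB : tight Q R B by case/and3P: pB.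
have vB : v \notin B by case/and3P: pB.
have [c cAB cv] := tight_pair_jumpC (tight_pairU pA tB vB).
suff cE : t = entry G v c.
  rewrite cE spC; apply: sp_single xA cAB _.
  by apply/subsetP => w; rewrite !inE; case: eqP => //=; case: (w \in A) => //; rewrite !andbF.
apply: sp_eq0 => //; rewrite -bt; apply: sp_single bB cAB _.
apply/subsetP => w; rewrite !inE; case: eqP => //= _.
by case: (w \in B) => //; rewrite !(andbF, orbT).
Qed.

(** Dual argument: an inner vector of the pair given by [A :&: (v |: B)] is tested against the outer
    vector of [B], then against [y]. *)
Lemma bad_type_outside Q R v t A y : bad_type Q R v t -> tight_pair Q R v A ->
  y \in LX (V :\: A) -> sp t (entry G v y) = 0%R.
Proof.
case=> t0 [B [pB [_ [b bB bt]]]] pA yA.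
have tvB : tight Q R (v |: B) by case/and3P: pB.
have [c cAB cv] := tight_pair_jump (tight_pairI pA tvB (setU11 _ _)).
have vA : v \notin A by case/and3P: pA.
suff cE : t = entry G v c.
  rewrite cE; apply: sp_single cAB yA _.
  by apply/subsetP => w; rewrite !inE; case: eqP => //=; case: (w \in A) => //; rewrite !andbF.
apply: sp_eq0 => //; rewrite -bt; apply: sp_single bB cAB _.
apply/subsetP => w; rewrite !inE; case: eqP => //= _.
by case: (w \in B) => //; rewrite !andbF.
Qed.

Lemma bad_type_uniq Q R v s t : bad_type Q R v s -> bad_type Q R v t -> s = t.
Proof.
move=> bs [t0 [A [pA [[x xA xt] _]]]]; rewrite -xt in t0 *.
by apply: sp_eq0 => //; [case: bs | exact: bad_type_inside bs pA xA].
Qed.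

(** The drop in rank makes the counted space larger than [LX X], but by one dimension at most, since
    a second type condition at [v] forces a zero entry there. *)
Lemma minor_half v t (H : sgraph W) X k : t != 0%R -> v \in V ->
    is_minor_of_type G H v t -> X \subset V :\ v ->
    k <= cutrank G X -> cutrank H X < k ->
  cutrank G X = k /\ exists2 x, x \in LX (v |: X) & entry G v x = t.
Proof.
move=> t0 vV [HV rkH] XVv; have [o0 _ _ ot _] := other_types t.
have vX : v \notin X by apply/negP => /(subsetP XVv); rewrite !inE eqxx.
have XV : X \subset V := subset_trans XVv (subsetDl _ _).
have := dim_supp_space XV; have := rkH _ XVv.
set U := (_ :&: _)%VS => rH rG kG kH; split; last first.
  have /subvPn[x] : ~~ (U <= LX X)%VS by apply/negP => /dimvS; lia.
  rewrite memv_cap memv_type_ker => /andP[xX /eqP tx] xnX; exists x => //.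
  have [x0|//] := sp_line t0 tx.
  by rewrite (supp_spaceU1 xX x0) in xnX.
suff : \dim U <= (\dim (LX X)).+1 by lia.
apply: leq_trans (dim_cap_type_ker G (other1 t) v U) _; rewrite ltnS.
apply/dimvS/subvP => x; rewrite !memv_cap !memv_type_ker => /andP[/andP[xX /eqP tx] /eqP ox].
by apply: supp_spaceU1 xX _; apply: sp_sep ox tx.
Qed.

(** A minimum cut without [v] is a cut of the minor. If [v] was in it, the smaller size pays for the
    type condition; otherwise its vectors vanish at [v] and satisfy the condition. *)
Lemma minor_connectivity_le Q R v t (H : sgraph W) :
    Q \subset V :\: R -> v \notin Q -> v \in V ->
    is_minor_of_type G H v t -> connectivity H Q R <= connectivity G Q R.
Proof.
move=> QR vQ vV [HV rkH]; have [X [QX XR <-]] := connectivity_attained QR.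
have XV : X \subset V := subset_trans XR (subsetDl _ _).
have QXv : Q \subset X :\ v.
  apply/subsetP => w wQ; rewrite !inE (subsetP QX) // andbT.
  by apply: contraNneq vQ => <-.
have XvH : X :\ v \subset vset H :\: R.
  rewrite HV; apply/subsetP => w; rewrite !inE => /andP[wv /(subsetP XR)].
  by rewrite !inE wv.
apply: leq_trans (connectivity_le QXv XvH) _.
have := rkH _ (setSD [set v] XV); have := dim_supp_space XV.
have := cardsD1 v X; have [vX|vX] := boolP (v \in X).
  by rewrite setD1K //; have := dim_cap_type_ker G t v (LX X); lia.
suff : \dim (LX X) <= \dim (LX (v |: X :\ v) :&: type_ker G t v) by lia.
apply/dimvS/subvP => x xX; rewrite memv_cap memv_type_ker; apply/andP; split.
  apply: subvP xX; apply: supp_spaceS; apply/subsetP => w; rewrite !inE => ->.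
  by case: eqP.
by move/supp_spaceP: xX => ->//; rewrite raddf0.
Qed.

(** For a cheaper cut [X] of the minor, [minor_half] applies to [X] and to the complement of
    [v |: X]; thus [X] and [v |: X] are minimum cuts of [G], with a vector of entry [t] on each
    side. *)
Lemma bad_type_minor Q R v t (H : sgraph W) : t != 0%R ->
    Q \subset V :\: R -> v \in V -> v \notin Q -> v \notin R ->
    is_minor_of_type G H v t -> connectivity H Q R != connectivity G Q R ->
  bad_type Q R v t /\ 0 < connectivity G Q R.
Proof.
move=> t0 QR vV vQ vR mH; have HV : vset H = V :\ v by case: mH.
rewrite neq_ltn orbC ltnNge (minor_connectivity_le QR vQ vV mH) /= => ltk.
split; last exact: leq_ltn_trans ltk.
have QHR : Q \subset vset H :\: R.
  rewrite HV; apply/subsetP => w wQ; have := subsetP QR w wQ.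
  by rewrite !inE => /andP[-> ->]; rewrite andbT /=; apply: contraNneq vQ => <-.
have [X [QX XHR eX]] := connectivity_attained QHR.
have XH : X \subset vset H := subset_trans XHR (subsetDl _ _).
have vX : v \notin X by apply/negP => /(subsetP XH); rewrite HV !inE eqxx.
have XR : X \subset V :\: R by apply: subset_trans XHR _; rewrite HV setSD ?subsetDl.
have vXR : v |: X \subset V :\: R by rewrite subUset XR sub1set inE vR vV.
have XV : X \subset V := subset_trans XR (subsetDl _ _).
have vXV : v |: X \subset V := subset_trans vXR (subsetDl _ _).
have QvX : Q \subset v |: X := subset_trans QX (subsetUr _ _).
have HXE : vset H :\: X = V :\: (v |: X).
  by rewrite HV; apply/setP => w; rewrite !inE; case: eqP => //=; rewrite ?andbF.
have [] := @minor_half v t H X _ t0 vV mH _ (connectivity_le QX XR); rewrite -?HV ?eX //.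
move=> rX ax; have [] := @minor_half v t H (V :\: (v |: X)) (connectivity G Q R) t0 vV mH.
- by rewrite -HXE -HV subsetDl.
- by rewrite cutrankC // connectivity_le.
- by rewrite -HXE cutrankC // eX.
rewrite cutrankC // setD_U1 // => rvX bx; split=> //; exists X; split=> //.
by rewrite /tight_pair /tight vX QX XR QvX vXR rX rvX eqxx.
Qed.
End Tight.

(** * Least pairs of minimum cuts at a vertex *)

Section Least.
Variables (W : finType) (G : sgraph W).
Implicit Types (A B Q R : {set W}) (v w : W).

Lemma least_set (P : pred {set W}) (A0 : {set W}) :
    P A0 -> (forall A B, P A -> P B -> P (A :&: B)) ->
  exists2 A, P A & forall B, P B -> A \subset B.
Proof.
move=> PA0 PI; case: (arg_minnP (fun A : {set W} => #|A|) PA0) => A PA minA.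
exists A => // B PB; apply/setIidPl/eqP.
by rewrite eqEcard subsetIl minA ?PI.
Qed.

Lemma least_tight Q R : Q \subset vset G :\: R ->
  exists2 A, tight G Q R A & forall B, tight G Q R B -> A \subset B.
Proof.
move=> QR; have [X [QX XR eX]] := connectivity_attained QR.
by apply: (@least_set _ X); [rewrite /tight QX XR eX eqxx | exact: tightI].
Qed.

Definition least_pair Q R v : {set W} :=
  odflt set0 [pick A | tight_pair G Q R v A & [forall B, tight_pair G Q R v B ==> (A \subset B)]].

Lemma least_pairP Q R v t : bad_type G Q R v t ->
  tight_pair G Q R v (least_pair Q R v) /\
  forall B, tight_pair G Q R v B -> least_pair Q R v \subset B.
Proof.
case=> _ [A0 [pA0 _]]; rewrite /least_pair.
case: pickP => [A /andP[pA /forallP hA]|none].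
  by split=> // B; apply/implyP.
have pI A B : tight_pair G Q R v A -> tight_pair G Q R v B -> tight_pair G Q R v (A :&: B).
  case/and3P=> vA tA tvA /and3P[vB tB tvB].
  by rewrite /tight_pair inE (negbTE vA) setUIr !tightI.
have [A pA hA] := least_set pA0 pI.
have /negP[] := negbT (none A); rewrite pA; apply/forallP => B.
by apply/implyP/hA.
Qed.

(** Intersecting the least pair at [w] with the minimum cut [least_pair Q R v] again gives a pair at
    [w], so the former lies in the latter and misses [w]. This makes choices of smallest size
    effective. *)
Lemma least_pair_card Q R v w s t : bad_type G Q R v s -> bad_type G Q R w t ->
  w \in least_pair Q R v -> #|least_pair Q R w| < #|least_pair Q R v|.
Proof.
move=> /least_pairP[pv _] /least_pairP[pw minw] wv; apply: proper_card.
have tv : tight G Q R (least_pair Q R v) by case/and3P: pv.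
have /subsetIP[_ sub] := minw _ (tight_pairI pw tv wv).
apply/properP; split=> //; exists w => //.
by case/and3P: pw.
Qed.
End Least.

(** * Dimension bounds and linking *)

Section Dimensions.
Local Open Scope ring_scope.
Variables (W : finType) (G : sgraph W).
Implicit Types (X Y S Q R P : {set W}) (U : {vspace vecs W}) (v w : W).
Local Notation LX := (supp_space G).

(** Restricting [U] to one type at a vertex of [S] costs at most one dimension and removes that
    vertex from the sum. *)
Lemma isotropic_dim S U :
    (forall x y, x \in U -> y \in U -> \sum_(w in S) sp (entry G w x) (entry G w y) = 0) ->
  (\dim U <= #|S| + \dim (U :&: LX (~: S)))%N.
Proof.
have [n] := ubnP #|S|; elim: n S U => // n IH S U /ltnSE leSn iso.
have [->|[w wS]] := set_0Vmem S.
  rewrite cards0 add0n; apply/dimvS/subvP => x xU; rewrite memv_cap xU.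
  by apply/supp_spaceP => w; rewrite !inE.
pose S1 := S :\ w; have cS := cardsD1 w S; rewrite wS add1n in cS.
have sumS x y : \sum_(u in S) sp (entry G u x) (entry G u y) =
    sp (entry G w x) (entry G w y) + \sum_(u in S1) sp (entry G u x) (entry G u y).
  rewrite (bigD1 w) //=; congr (_ + _); apply: eq_bigl => u.
  by rewrite !inE andbC.
have memS x : x \in LX (~: S1) -> entry G w x = 0 -> x \in LX (~: S).
  move=> /supp_spaceP sx xw; apply/supp_spaceP => u; rewrite inE negbK => uS.
  by have [->//|uw] := eqVneq u w; apply: sx; rewrite !inE negbK uw.
suff [t t0 ht] : exists2 t, t != 0 & forall y, y \in U -> y \in LX (~: S1) ->
    sp t (entry G w y) = 0 -> entry G w y = 0.
  have := dim_cap_type_ker G t w U; set U1 := (U :&: type_ker _ _ _)%VS => dimU.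
  have iso1 x y : x \in U1 -> y \in U1 -> \sum_(u in S1) sp (entry G u x) (entry G u y) = 0.
    rewrite !memv_cap !memv_type_ker => /andP[xU /eqP tx] /andP[yU /eqP ty].
    by have := iso x y xU yU; rewrite sumS (sp_isotropic t0 tx ty) add0r.
  have := IH S1 U1 _ iso1; have : (\dim (U1 :&: LX (~: S1)) <= \dim (U :&: LX (~: S)))%N.
    apply/dimvS/subvP => y; rewrite !memv_cap memv_type_ker => /andP[/andP[yU /eqP ty] yS1].
    by rewrite yU memS //; apply: ht.
  by move: leSn dimU; rewrite cS -/S1; lia.
(* If some [x] in [U] vanishes on [S1] but not at [w], isotropy puts the entries at [w] of all such
   vectors on one line, and a type off that line serves; otherwise any type does. *)
have [sub|/subvPn[x]] := boolP (U :&: LX (~: S1) <= LX (~: S))%VS.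
  exists (1, 0) => // y yU yS1 _.
  have /supp_spaceP : y \in LX (~: S) by apply: (subvP sub); rewrite memv_cap yU.
  by apply; rewrite inE wS.
rewrite memv_cap => /andP[xU xS1] xnS.
have xw : entry G w x != 0 by apply: contra xnS => /eqP; exact: memS.
have [o0 _ _ ot _] := other_types (entry G w x).
exists (other1 (entry G w x)) => // y yU yS1 oy.
apply: sp_sep oy (_ : sp (entry G w x) _ = 0) => //.
have := iso x y xU yU; rewrite sumS big1 ?addr0 // => u uS1.
have -> : entry G u x = 0 by move/supp_spaceP: xS1; apply; rewrite inE negbK.
by rewrite spC raddf0.
Qed.

(** The given vectors have independent restrictions to [C], and the intersection is the kernel of
    restriction. *)
Lemma dim_separated (C : {set W}) U :
    (forall w, w \in C -> exists2 x, x \in U &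
       entry G w x != 0 /\ forall w', w' \in C -> w' != w -> entry G w' x = 0) ->
  (#|C| + \dim (U :&: LX (~: C)) <= \dim U)%N.
Proof.
have [n] := ubnP #|C|; elim: n C U => // n IH C U /ltnSE leCn sep.
have [->|[w wC]] := set_0Vmem C.
  by rewrite cards0 add0n dimvS ?capvSl.
pose C1 := C :\ w; have cC := cardsD1 w C; rewrite wC add1n in cC.
set U1 := (U :&: entry_ker G w)%VS.
have lt_dim : (\dim U1 < \dim U)%N.
  rewrite ltnNge; apply/negP => le_dim; have [x xU [xw _]] := sep w wC.
  have /eqP eU : U1 == U by rewrite eqEdim capvSl.
  by move: xU xw; rewrite -eU memv_cap memv_entry_ker => /andP[_ ->].
have := IH C1 U1; have : (\dim (U :&: LX (~: C)) <= \dim (U1 :&: LX (~: C1)))%N.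
  apply/dimvS/subvP => x; rewrite !memv_cap memv_entry_ker => /andP[-> /supp_spaceP sx] /=.
  rewrite sx ?eqxx ?inE ?wC //=; apply/supp_spaceP => u; rewrite !inE negbK => /andP[_ uC].
  by apply: sx; rewrite inE uC.
suff sep1 : forall w0, w0 \in C1 -> exists2 x, x \in U1 &
    entry G w0 x != 0 /\ forall w', w' \in C1 -> w' != w0 -> entry G w' x = 0.
  by move=> ledim /(_ _ sep1); move: leCn lt_dim; rewrite cC -/C1; lia.
move=> u; rewrite !inE => /andP[uw uC]; have [x xU [xu xz]] := sep u uC.
exists x; first by rewrite memv_cap xU memv_entry_ker xz ?eqxx // eq_sym.
by split=> // w'; rewrite !inE => /andP[_ w'C]; exact: xz.
Qed.

(** The quotient of [U] by [Z] in coordinates, with values in a finite type so that classes can be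
    counted. *)
Lemma quotient_map (vT : vectType 'F_2) (U Z : {vspace vT}) : (Z <= U)%VS ->
  exists cl : vT -> 'rV['F_2]_(\dim U - \dim Z),
    forall x y, x \in U -> y \in U -> cl x = cl y -> x - y \in Z.
Proof.
move=> ZU; set C := (U :\: Z)%VS.
have dC : \dim C = (\dim U - \dim Z)%N.
  by have := dimv_cap_compl U Z; rewrite (capv_idPr ZU) => <-; rewrite addKn.
rewrite -dC; exists (fun x => \row_i coord (vbasis C) i (addv_pi1 U Z x)) => x y xU yU /rowP e.
have memC z : addv_pi1 U Z z \in C by exact: memv_pi.
have sub z : z \in U -> z \in (U + Z)%VS by apply/subvP/addvSl.
have e1 : addv_pi1 U Z x = addv_pi1 U Z y.
  rewrite (coord_vbasis (memC x)) (coord_vbasis (memC y)).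
  by apply: eq_bigr => i _; have := e i; rewrite !mxE => ->.
have subE (a b c : vT) : a + b = x -> a + c = y -> x - y = b - c.
  by move=> <- <-; rewrite opprD addrACA subrr add0r.
have dy := addv_pi1_pi2 (sub y yU); rewrite -e1 in dy.
by rewrite (subE _ _ _ (addv_pi1_pi2 (sub x xU)) dy) rpredB ?memv_pi2.
Qed.

Definition retype (t : W -> plane) w s u := if u == w then s else t u.

Lemma type_space_retype P t w s : w \notin P ->
  type_space G (w |: P) (retype t w s) = (type_space G P t :&: type_ker G s w)%VS.
Proof.
move=> wP; apply/vspaceP => x; rewrite memv_cap memv_type_ker.
apply/type_spaceP/andP => [h|[/type_spaceP h /eqP xw] u].
  split; last by have := h w (setU11 _ _); rewrite /retype eqxx => ->.
  apply/type_spaceP => u uP; have := h u (setU1r _ uP); rewrite /retype.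
  by case: eqP => // uw; rewrite -uw uP in wP.
by rewrite !inE /retype; case: eqP => [->|_] //=; apply: h.
Qed.

(* If both [p] and [q] failed, submodularity applied to [X1] and [X2] would contradict the
   bound for [X1 :&: X2] or for [w |: (X1 :|: X2)]. *)
Lemma linking_step Q (M : {set W}) P (k : nat) (N : {vspace vecs W}) w p q :
    w \in M -> w \notin P -> p != 0 -> q != 0 -> p != q ->
    (forall X : {set W}, Q \subset X -> X \subset M -> [disjoint X & P] ->
      (\dim (LX (X :|: P) :&: N) + k <= #|X|)%N) ->
    forall X1 X2 : {set W}, Q \subset X1 -> X1 \subset M -> [disjoint X1 & w |: P] ->
      Q \subset X2 -> X2 \subset M -> [disjoint X2 & w |: P] ->
    (\dim (LX (X1 :|: (w |: P)) :&: (N :&: type_ker G p w)) + k <= #|X1|)%N \/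
    (\dim (LX (X2 :|: (w |: P)) :&: (N :&: type_ker G q w)) + k <= #|X2|)%N.
Proof.
move=> wM wP p0 q0 pq kt X1 X2 QX1 X1M X1P QX2 X2M X2P.
have wX1 : w \notin X1 by rewrite (disjointFl X1P) ?setU11.
have wX2 : w \notin X2 by rewrite (disjointFl X2P) ?setU11.
have {}X1P : [disjoint X1 & P] by apply: disjointWr X1P; apply: subsetUr.
have {}X2P : [disjoint X2 & P] by apply: disjointWr X2P; apply: subsetUr.
have kU : (\dim (LX (w |: (X1 :|: X2) :|: P) :&: N) + k <= #|w |: (X1 :|: X2)|)%N.
  apply: kt; first by rewrite (subset_trans QX1) // setUCA subsetUl.
    by rewrite !subUset sub1set wM X1M.
  by rewrite disjoints_subset !subUset -!disjoints_subset X1P X2P disjoints1 wP.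
have kI : (\dim (LX (X1 :&: X2 :|: P) :&: N) + k <= #|X1 :&: X2|)%N.
  apply: kt; first by rewrite subsetI QX1.
    by rewrite subIset ?X1M.
  by apply: disjointWl X1P; apply: subsetIl.
have cU : #|w |: (X1 :|: X2)| = #|X1 :|: X2|.+1 by rewrite cardsU1 !inE negb_or wX1 wX2.
have := cardsUI X1 X2; rewrite cU in kU.
set M1 := (_ :&: (_ :&: type_ker G p w))%VS.
set M2 := (_ :&: (_ :&: type_ker G q w))%VS.
have := dimv_sum_cap M1 M2.
have : (\dim (M1 + M2) <= \dim (LX (w |: (X1 :|: X2) :|: P) :&: N))%N.
  have sub X s : X \subset X1 :|: X2 ->
      (LX (X :|: (w |: P)) :&: (N :&: type_ker G s w) <= LX (w |: (X1 :|: X2) :|: P) :&: N)%VS.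
    move=> XX; apply: capvS (capvSl _ _); rewrite setUCA -setUA.
    by apply/supp_spaceS/setUS/setSU.
  apply: dimvS; rewrite subv_add; apply/andP; split.
    exact: (sub X1 p (subsetUl _ _)).
  exact: (sub X2 q (subsetUr _ _)).
have : (\dim (M1 :&: M2) <= \dim (LX (X1 :&: X2 :|: P) :&: N))%N.
  apply: dimvS.
  apply/subvP => x.
  rewrite memv_cap [in X in _ -> X]memv_cap.
  rewrite /M1 /M2.
  rewrite 4!memv_cap.
  rewrite !memv_type_ker.
  case/andP=> /and3P[x1 xN /eqP xp] /and3P[x2 _ /eqP xq]; rewrite xN andbT.
  apply: (@supp_spaceU1 _ _ w); last exact: sp_sep pq xp xq.
  by rewrite setUCA setUIl -supp_spaceI memv_cap x1.
move=> hI hU hd hc.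
have {kU}hU : (\dim (M1 + M2) + k <= #|X1 :|: X2|.+1)%N.
  by apply: leq_trans kU; rewrite leq_add2r.
have {kI}hI : (\dim (M1 :&: M2) + k <= #|X1 :&: X2|)%N.
  by apply: leq_trans kI; rewrite leq_add2r.
move: hI hU hd hc; move: (\dim (M1 + M2)) (\dim (M1 :&: M2)) (\dim M1) (\dim M2).
clear; lia.
Qed.

(** An analogue of Tutte's linking theorem: with the vertices of [P] removed in the ways [t], [#|X|]
    minus the dimension plays the role of the cut-rank of [X], and [P] grows by one vertex at a
    time. *)
Lemma linking Q R k : Q \subset vset G :\: R ->
    (forall X : {set W}, Q \subset X -> X \subset vset G :\: R -> k <= cutrank G X)%N ->
    forall p q : W -> plane, (forall w, [/\ p w != 0, q w != 0 & p w != q w]) ->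
  exists t : W -> plane, (forall w, t w = p w \/ t w = q w) /\
    (\dim (LX (vset G :\: R) :&: type_space G ((vset G :\: R) :\: Q) t) + k <= #|Q|)%N.
Proof.
move=> QV rk p q pq; set M := vset G :\: R.
have MV : M \subset vset G by apply: subsetDl.
suff main P : P \subset M :\: Q -> exists t : W -> plane, (forall w, t w = p w \/ t w = q w) /\
    forall X : {set W}, Q \subset X -> X \subset M -> [disjoint X & P] ->
    (\dim (LX (X :|: P) :&: type_space G P t) + k <= #|X|)%N.
  have [t [ht kt]] := main _ (subxx _); exists t; split=> //.
  have := kt Q (subxx _) QV; have -> : Q :|: M :\: Q = M.
    by apply/setP => w; rewrite !inE; case: (boolP (w \in Q)) => //= /(subsetP QV); rewrite inE.
  by apply; rewrite disjoint_sym disjoints_subset; apply/subsetP => w; rewrite !inE => /andP[].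
have [n] := ubnP #|P|; elim: n P => // n IH P /ltnSE leP PMQ.
have [->|[w wP]] := set_0Vmem P.
  exists p; split=> [|X QX XM _]; first by left.
  apply: leq_trans (_ : \dim (LX X) + k <= _)%N.
    by rewrite leq_add2r setU0 dimvS ?capvSl.
  have := rk X QX XM; have := dim_supp_space (subset_trans XM MV); lia.
have [P1 wP1 PE] : exists2 P1 : {set W}, w \notin P1 & P = w |: P1.
  by exists (P :\ w); rewrite ?setD1K // !inE eqxx.
rewrite {}PE cardsU1 wP1 add1n in leP PMQ *.
have [|t [ht kt]] := IH P1 leP; first by apply: subset_trans PMQ; apply: subsetUr.
have [pw0 qw0 pqw] := pq w.
have wM : w \in M by have := subsetP PMQ w (setU11 _ _); rewrite inE => /andP[].
have step := linking_step wM wP1 pw0 qw0 pqw kt.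
have tsE s : s = p w \/ s = q w -> forall u, retype t w s u = p u \/ retype t w s u = q u.
  by move=> hs u; rewrite /retype; case: eqP => [->|].
(* If one set [X1] defeats the type [p w], then [linking_step] with this [X1] validates [q w] for
   every [X]. *)
have [/existsP[X1 /and4P[QX1 X1M X1P]]|none] := boolP [exists X : {set W},
    [&& Q \subset X, X \subset M, [disjoint X & w |: P1] &
      ~~ (\dim (LX (X :|: (w |: P1)) :&: (type_space G P1 t :&: type_ker G (p w) w)) + k
         <= #|X|)%N]].
  move=> /negP bad; exists (retype t w (q w)); split; first by apply: tsE; right.
  move=> X QX XM XP; rewrite type_space_retype //.
  by case: (step X1 X QX1 X1M X1P QX XM XP).
exists (retype t w (p w)); split; first by apply: tsE; left.
move=> X QX XM XP; rewrite type_space_retype //.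
by move/existsPn/(_ X): none; rewrite QX XM XP /= negbK.
Qed.
End Dimensions.

(** * Locally isotropic spaces avoiding the bad types of [(S, T)] *)

Section TypedVectors.
Local Open Scope ring_scope.
Variables (W : finType) (G : sgraph W).
Implicit Types (v w : W).
Local Notation V := (vset G).
Local Notation LX := (supp_space G).
Local Notation least := (least_pair G).

Lemma dim_type_space (P : {set W}) t (U : {vspace vecs W}) :
  (\dim U <= \dim (U :&: type_space G P t) + #|P|)%N.
Proof.
have [n] := ubnP #|P|; elim: n P => // n IH P /ltnSE leP.
have [->|[w wP]] := set_0Vmem P.
  rewrite cards0 addn0; apply/dimvS/subvP => x xU; rewrite memv_cap xU.
  by apply/type_spaceP => w; rewrite inE.
have cP : #|P| = #|P :\ w|.+1 by rewrite (cardsD1 w) wP.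
have := IH (P :\ w); set N := (U :&: _)%VS; have := dim_cap_type_ker G (t w) w N.
suff : (\dim (N :&: type_ker G (t w) w) <= \dim (U :&: type_space G P t))%N by lia.
apply/dimvS/subvP => x; rewrite !memv_cap memv_type_ker => /andP[/andP[-> /type_spaceP h] /eqP xw].
apply/type_spaceP => u uP; have [->//|uw] := eqVneq u w.
by apply: h; rewrite !inE uw.
Qed.

Section Upper.
Variables (S T F M S0 : {set W}) (b theta : W -> plane).
Hypotheses (badS : forall v, v \in F -> bad_type G S T v (b v))
  (tS0 : tight G S T S0) (minS0 : forall B, tight G S T B -> S0 \subset B)
  (TV : T \subset V) (MV : M \subset F :|: S :|: T) (th0 : forall v, theta v != 0)
  (thb : forall v, v \in F -> theta v != b v).

Let Gamma := (LX M :&: type_space G setT theta)%VS.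

(** A vector that splits along [S0] and is nonzero somewhere on [F] would take the entry [b v] at
    some [v] in [F], which [theta] excludes. *)
Lemma typed_restriction x : x \in Gamma -> x \in (LX S0 + LX (~: S0))%VS -> x \in LX (~: F).
Proof.
rewrite memv_cap => /andP[/supp_spaceP xM /type_spaceP xth] /memv_addP[q qS [z zS xE]].
move/supp_spaceP: qS => qS; move/supp_spaceP: zS => zS.
have zx u : u \notin S0 -> entry G u z = entry G u x.
  by move=> uS; rewrite xE raddfD /= qS // add0r.
apply/supp_spaceP => f; rewrite inE negbK => fF; apply/eqP/negPn/negP => xf.
(* As [v] has a smallest set [least S T v], that set misses the support of [z], which forces
   the entry of [z] at [v] into the line of [b v]. *)
pose P := [pred v in F | entry G v x != 0].
have Pf : P f by rewrite /= fF.
case: (arg_minnP (fun v => #|least S T v|) Pf) => v /andP[vF xv] minv.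
have [pv _] := least_pairP (badS vF).
have [vB tB] : v \notin least S T v /\ tight G S T (least S T v) by case/and3P: pv.
have S0B := minS0 tB.
have vS0 : v \notin S0 by apply: contra vB => /(subsetP S0B).
have zB : z \in LX (V :\: least S T v).
  apply/supp_spaceP => u; rewrite inE negb_and negbK => /orP[uB|uV]; last first.
    have uS : u \notin S0 by apply: contra uV => /(subsetP (tight_subV tS0)).
    rewrite zx //; apply: xM; apply: contra uV => /(subsetP MV).
    rewrite !inE -orbA => /or3P[uF|uS'|uT].
    - by have [/tight_pair_inV] := least_pairP (badS uF).
    - case/and3P: tS0 => /subsetP/(_ _ uS') uS0 _ _.
      by rewrite uS0 in uS.
    - by apply: (subsetP TV).
  have [uS|uS] := boolP (u \in S0); first by apply: zS; rewrite inE negbK.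
  rewrite zx //; have [uM|] := boolP (u \in M); last exact: xM.
  apply/eqP/negPn/negP => xu; have := subsetP MV u uM; rewrite !inE -orbA => /or3P[uF|uS'|uT].
  - have := minv u; rewrite /= uF xu => /(_ isT); rewrite leqNgt => /negP[].
    exact: least_pair_card (badS vF) (badS uF) uB.
  - case/and3P: tS0 => /subsetP/(_ _ uS') uS0 _ _.
    by rewrite uS0 in uS.
  - by case/and3P: tB => _ /subsetP/(_ u uB); rewrite inE uT.
have := bad_type_outside (badS vF) pv zB; rewrite zx // => bx.
have b0 : b v != 0 by case: (badS vF).
have [x0|xb] := sp_line b0 bx; first by rewrite x0 eqxx in xv.
have := xth v (in_setT v); rewrite xb => tb; have := thb vF.
by rewrite (sp_eq0 (th0 v) b0 tb) eqxx.
Qed.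
(** On [S0], [Gamma] is locally isotropic, [Z] vanishes and [L] is orthogonal to everything, so
    [isotropic_dim] bounds [Gamma + (L + Z)]; the connectivity enters through the dimension of
    [L]. *)
Lemma typed_dim : (\dim Gamma <= connectivity G S T + \dim (Gamma :&: LX (~: F)))%N.
Proof.
set L := LX S0; set Z := LX (~: S0).
have LZ0 : (L :&: Z = 0)%VS by rewrite supp_spaceI setICr supp_space0.
have sL u q : q \in L -> \sum_(w in S0) sp (entry G w u) (entry G w q) = 0.
  move=> /supp_spaceP qL; have := sum_sp_entry G u q; rewrite (bigID (mem S0)) /=.
  by rewrite [X in _ + X]big1 ?addr0 // => w /qL->; rewrite raddf0.
have iso x y : x \in (Gamma + (L + Z))%VS -> y \in (Gamma + (L + Z))%VS ->
    \sum_(w in S0) sp (entry G w x) (entry G w y) = 0.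
  move=> /memv_addP[g gG [_ /memv_addP[q qL [z zZ ->]] ->]].
  move=> /memv_addP[g' gG' [_ /memv_addP[q' qL' [z' zZ' ->]] ->]].
  have zw u w : u \in Z -> w \in S0 -> entry G w u = 0.
    by move=> /supp_spaceP uZ wS; apply: uZ; rewrite inE negbK.
  transitivity (\sum_(w in S0) (sp (entry G w (g + q)) (entry G w q') +
                   sp (entry G w g') (entry G w q))).
    apply: eq_bigr => w wS; have vD u s : entry G w (u + s) = entry G w u + entry G w s.
      exact: raddfD.
    rewrite !vD (zw _ _ zZ wS) (zw _ _ zZ' wS) !addr0.
    have gg : sp (entry G w g) (entry G w g') = 0.
      move: gG gG'; rewrite !memv_cap => /andP[_ /type_spaceP h] /andP[_ /type_spaceP h'].
      by apply: (sp_isotropic (th0 w)); [apply: h | apply: h'].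
    by rewrite spDr [sp _ (entry G w g')]spDl gg add0r addrC [sp (entry G w q) _]spC.
  by rewrite big_split /= !sL // addr0.
have := isotropic_dim iso; have := dim_supp_space (tight_subV tS0).
have := dimv_sum_cap Gamma (L + Z)%VS; rewrite (tight_rank tS0) (dimv_disjoint_sum LZ0).
have : (\dim (Gamma :&: (L + Z)) <= \dim (Gamma :&: LX (~: F)))%N.
  apply: dimvS; apply/subvP => x; rewrite memv_cap => /andP[xG xLZ].
  by rewrite memv_cap xG; apply: typed_restriction.
have : (\dim ((Gamma + (L + Z)) :&: Z) <= \dim Z)%N by rewrite dimvS ?capvSr.
rewrite -/L -/Z; move: (\dim (Gamma + (L + Z))) (\dim (Gamma :&: (L + Z))).
move: (\dim (Gamma :&: LX (~: F))) (\dim ((Gamma + (L + Z)) :&: Z)).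
move: (\dim Gamma) (\dim L) (\dim Z); clear; lia.
Qed.
End Upper.
End TypedVectors.

(** * Vectors realizing the bad types of [(Q, R)] *)

Section Lower.
Local Open Scope ring_scope.
Variables (W : finType) (G : sgraph W).
Local Notation V := (vset G).
Local Notation LX := (supp_space G).
Variables (Q R F Q0 : {set W}) (a t : W -> plane).
Local Notation A := (least_pair G Q R).
Local Notation M := ((V :\: R) :\: Q0).
Hypotheses (badQ : forall v, v \in F -> bad_type G Q R v (a v))
  (tQ0 : tight G Q R Q0) (minQ0 : forall B, tight G Q R B -> Q0 \subset B)
  (t0 : forall v, t v != 0)
  (dimt : (\dim (LX (V :\: R) :&: type_space G M t) + connectivity G Q R <= #|Q0|)%N).

Let a0 v : v \in F -> a v != 0. Proof. by case/badQ. Qed.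

Let least_facts v : v \in F -> [/\ v \in V, v \notin A v, v \notin Q0, Q0 \subset A v &
  (v |: A v) \subset V :\: R].
Proof.
move=> vF; have [pv _] := least_pairP (badQ vF); have vV := tight_pair_inV pv.
case/and3P: pv => vA tA /and3P[_ AR _]; have Q0A := minQ0 tA.
by split=> //; apply: contra vA => /(subsetP Q0A).
Qed.

Definition typed_vector v (x : vecs W) :=
  [/\ x \in LX (v |: A v), forall u, u \notin Q0 -> u != v -> sp (t u) (entry G u x) = 0,
      entry G v x = a v & sp (t v) (a v) != 0].

(** Imposing the types on [A v :\: Q0] leaves dimension at least [#|Q0| + 1 - k], with [k] the
    connectivity of [(Q, R)], one more than [dimt] allows. Hence some vector violates the type at
    [v], and its entry there must be [a v]. *)
Lemma typed_vector_exists v : v \in F -> exists x, typed_vector v x.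
Proof.
move=> vF; have [vV vA vQ0 Q0A vAR] := least_facts vF.
have [pv _] := least_pairP (badQ vF).
have tvA : tight G Q R (v |: A v) by case/and3P: pv.
set U := LX (v |: A v); set N := (U :&: type_space G (A v :\: Q0) t)%VS.
set T0 := (LX (V :\: R) :&: type_space G M t)%VS.
have /subvPn[x xN xT0] : ~~ (N <= T0)%VS.
  apply/negP => /dimvS le_dim.
  have := dim_type_space G (A v :\: Q0) t U; have := dim_supp_space (tight_subV tvA).
  rewrite (tight_rank tvA) cardsU1 vA -/U -/N cardsD (setIidPr Q0A).
  have := subset_leq_card Q0A; move: dimt le_dim; rewrite -/T0.
  move: (\dim U) (\dim N) (\dim T0); clear; lia.
move: xN; rewrite memv_cap => /andP[xU /type_spaceP xt].
have types u : u \notin Q0 -> u != v -> sp (t u) (entry G u x) = 0.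
  move=> uQ0 uv; have [uA|uA] := boolP (u \in A v); first by apply: xt; rewrite inE uQ0.
  by move/supp_spaceP: xU => ->; rewrite ?raddf0 // !inE negb_or uv.
have tv : sp (t v) (entry G v x) != 0.
  apply: contra xT0 => /eqP tv; rewrite memv_cap (subvP (supp_spaceS G vAR)) //=.
  apply/type_spaceP => u; rewrite inE => /andP[uQ0 _].
  by have [->|uv] := eqVneq u v => //; apply: types.
have xv : entry G v x = a v.
  have [x0|//] := sp_line (a0 vF) (bad_type_inside (badQ vF) pv xU).
  by rewrite x0 raddf0 eqxx in tv.
by exists x; split=> //; rewrite -xv.
Qed.

Variable al : W -> vecs W.
Hypothesis alP : forall v, v \in F -> typed_vector v (al v).

Let alS v u : v \in F -> u != v -> u \notin A v -> entry G u (al v) = 0.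
Proof.
by move=> /alP[/supp_spaceP h _ _ _] uv uA; apply: h; rewrite !inE negb_or uv.
Qed.

Let valB u x y : entry G u (x - y) = entry G u x - entry G u y.
Proof. exact: raddfB. Qed.

Let same v w := al v - al w \in (LX Q0 + LX (V :\: Q0))%VS.

Lemma same_diff v w : same v w -> exists2 s, s \in LX (V :\: Q0) &
  forall u, u \notin Q0 -> entry G u s = entry G u (al v) - entry G u (al w).
Proof.
move=> /memv_addP[q /supp_spaceP qQ [s sV e]]; exists s => // u uQ.
by rewrite -valB e raddfD /= qQ // add0r.
Qed.

Lemma same_zero v w : v \in F -> w \in F -> v != w -> (#|A v| <= #|A w|)%N ->
  same v w -> entry G v (al w) = 0.
Proof.
move=> vF wF vw Avw /same_diff[s sV sE].
have [vV vA vQ0 _ _] := least_facts vF.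
have [_ tv av tav] := alP vF; have [_ tw aw taw] := alP wF.
have wA : w \notin A v.
  by apply: contraL Avw => /(least_pair_card (badQ vF) (badQ wF)); rewrite -ltnNge.
(* In the orthogonality of [al v] and [s] only the term at [v] survives. *)
have av_s : sp (a v) (entry G v s) = 0.
  have := sum_sp_entry G (al v) s; rewrite (bigD1 v) //= av big1 ?addr0 // => u uv.
  have [uQ0|uQ0] := boolP (u \in Q0).
    by move/supp_spaceP: sV => ->; rewrite ?raddf0 // inE uQ0.
  have [uA|uA] := boolP (u \in A v); last by rewrite alS // spC raddf0.
  have uw : u != w by apply: contraTneq uA => ->.
  apply: (sp_isotropic (t0 u)); first exact: tv.
  by rewrite sE // raddfB /= tv // tw // subrr.
(* The entry is orthogonal to both [t v] and [a v], which are different. *)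
have a0v := a0 vF; apply: (sp_sep (t0 v) a0v) (tw _ vQ0 vw) _.
  by apply: contraNneq tav => ->; rewrite spxx.
by move: av_s; rewrite sE // av raddfB /= spxx sub0r => /eqP; rewrite oppr_eq0 => /eqP.
Qed.

Variables (C : {set W}) (v0 : W).
Hypotheses (CF : C \subset F) (v0C : v0 \in C)
  (minv0 : forall v, v \in C -> (#|A v0| <= #|A v|)%N)
  (sameC : forall v w, v \in C -> w \in C -> same v w).

Definition class_types u := if u \in C then a u else t u.

(** The difference [al v0 - al w], freed of its part on [Q0], is nonzero at [w] and zero on the rest
    of [C] except [v0]; the reference vertex [v0] is the one lost in the count. *)
Lemma typed_separated :
  (#|C :\ v0| + \dim ((LX M :&: type_space G setT class_types) :&: LX (~: (C :\ v0))) <=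
   \dim (LX M :&: type_space G setT class_types))%N.
Proof.
apply: dim_separated => w; rewrite !inE => /andP[wv0 wC].
have [s sV sE] := same_diff (sameC v0C wC).
have inF u : u \in C -> u \in F by move/(subsetP CF).
have CQ0 u : u \in C -> u \notin Q0 by move=> /inF/least_facts[].
have out0 u : u \in C -> u != v0 -> entry G u (al v0) = 0.
  move=> uC uv0; apply: alS => //; first exact: inF.
  apply: contraL (minv0 uC) => /(least_pair_card (badQ (inF _ v0C)) (badQ (inF _ uC))).
  by rewrite -ltnNge.
have outw u : u \in C -> u != w -> entry G u (al w) = 0.
  move=> uC uw; have [le|lt] := leqP #|A u| #|A w|.
    by apply: same_zero le _; rewrite ?inF ?sameC.
  apply: alS => //; first exact: inF.
  apply: contraL (ltnW lt) => /(least_pair_card (badQ (inF _ wC)) (badQ (inF _ uC))).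
  by rewrite -ltnNge.
have sw : entry G w s = - a w.
  by have [_ _ aw _] := alP (inF _ wC); rewrite sE ?CQ0 // out0 // aw sub0r.
exists s; last first.
  split=> [|u]; first by rewrite sw oppr_eq0 a0 ?inF.
  by rewrite !inE => /andP[uv0 uC] uw; rewrite sE ?CQ0 // out0 // outw // subrr.
rewrite memv_cap; apply/andP; split.
  apply/supp_spaceP => u; rewrite inE negb_and negbK => /orP[uQ0|uR].
    by move/supp_spaceP: sV; apply; rewrite inE uQ0.
  have [uQ0|uQ0] := boolP (u \in Q0); first by move/supp_spaceP: sV; apply; rewrite inE uQ0.
  have al0 v : v \in C -> entry G u (al v) = 0.
    move=> vC; have [_ _ _ _ sub] := least_facts (inF _ vC).
    have [/supp_spaceP + _ _ _] := alP (inF _ vC); apply.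
    by apply: contra uR => /(subsetP sub).
  by rewrite sE // !al0 // subrr.
apply/type_spaceP => u _; rewrite /class_types; have [uC|uC] := boolP (u \in C).
  rewrite sE ?CQ0 // raddfB /=; have [->|uv0] := eqVneq u v0.
    have [_ _ -> _] := alP (inF _ v0C).
    by rewrite spxx outw // 1?eq_sym // raddf0 subr0.
  rewrite out0 // raddf0 sub0r; have [->|uw] := eqVneq u w.
    by have [_ _ -> _] := alP (inF _ wC); rewrite spxx oppr0.
  by rewrite outw // raddf0 oppr0.
have [uQ0|uQ0] := boolP (u \in Q0).
  by move/supp_spaceP: sV => ->; rewrite ?raddf0 // inE uQ0.
have neC v : v \in C -> u != v by move=> vC; apply: contraNneq uC => ->.
have ty v : v \in C -> sp (t u) (entry G u (al v)) = 0.
  by move=> vC; have [_ -> //] := alP (inF _ vC); apply: neC.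
by rewrite sE // raddfB /= !ty // subrr.
Qed.
End Lower.

(** * Counting vertices class by class *)

Lemma fiber_bound (I J : finType) (F : {set I}) (f : I -> J) m :
  (forall c, #|[set v in F | f v == c]| <= m) -> #|F| <= m * #|J|.
Proof.
move=> h; rewrite -sum1_card (partition_big f predT) //= mulnC -sum_nat_const.
by apply: leq_sum => c _; rewrite sum1dep_card; apply: leq_trans (h c); rewrite cardsE.
Qed.

Section Incompatible.
Variables (W : finType) (G : sgraph W).
Local Notation V := (vset G).
Local Notation LX := (supp_space G).

Lemma incompatible_bound (Q R S T F : {set W}) (a b : W -> plane) :
    Q \subset V :\: R -> S \subset V :\: T -> T \subset V ->
    V :\: (Q :|: R) \subset F :|: S :|: T ->
    (forall v, v \in F -> [/\ bad_type G Q R v (a v), bad_type G S T v (b v) & a v != b v]) ->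
  #|F| <= (connectivity G S T).+1 * 2 ^ (2 * connectivity G Q R).
Proof.
move=> QVR SVT TV VF bad.
have badQ v : v \in F -> bad_type G Q R v (a v) by case/bad.
have badS v : v \in F -> bad_type G S T v (b v) by case/bad.
have [Q0 tQ0 minQ0] := least_tight QVR; have [S0 tS0 minS0] := least_tight SVT.
have [QQ0 Q0VR _] := and3P tQ0.
(* A set containing [Q0] contains [Q], so linking can start from [Q0] with the same bound on
   cut-ranks. *)
have rk (X : {set W}) : Q0 \subset X -> X \subset V :\: R -> connectivity G Q R <= cutrank G X.
  by move=> Q0X; apply: connectivity_le; apply: subset_trans Q0X.
have others w : [/\ other1 (b w) != 0%R, other2 (b w) != 0%R & other1 (b w) != other2 (b w)].
  by have [] := other_types (b w).
have [t [tE dimt]] := linking Q0VR rk others.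
have t0 w : t w != 0%R by have [? ? _ _ _] := other_types (b w); case: (tE w) => ->.
have tb w : t w != b w by have [_ _ _ ? ?] := other_types (b w); case: (tE w) => ->.
have [al alP] : exists al : W -> vecs W,
    forall v, v \in F -> typed_vector G Q R Q0 a t v (al v).
  apply: (@fin_all_exists W (fun=> vecs W)
    (fun v x => v \in F -> typed_vector G Q R Q0 a t v x)) => v.
  have [vF|_] := boolP (v \in F); last by exists 0%R.
  by have [x xP] := typed_vector_exists badQ minQ0 dimt vF; exists x.
set Z := (LX Q0 + LX (V :\: Q0))%VS.
have Q0V := tight_subV tQ0.
have [|cl clP] := @quotient_map _ (LX V) Z.
  by rewrite subv_add !supp_spaceS ?subsetDl.
have alV v : v \in F -> al v \in LX V.
  move=> vF; have [h _ _ _] := alP v vF; apply: (subvP _ _ h); apply: supp_spaceS.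
  have [/and3P[_ _ /tight_subV //]] := least_pairP (badQ v vF).
have sameP v w : v \in F -> w \in F -> cl (al v) = cl (al w) -> (al v - al w)%R \in Z.
  by move=> vF wF; apply: clP; apply: alV.
(* With [k] the connectivity of [(Q, R)], the summands of [Z] have dimensions [#|Q0| - k] and
   [#|V| - #|Q0| - k], and [LX V] has dimension at most [#|V|]. *)
have dimZ : \dim (LX V) - \dim Z <= 2 * connectivity G Q R.
  have := dim_supp_space (subxx V); have := dim_supp_space Q0V.
  have := dim_supp_space (subsetDl V Q0); rewrite cutrankC // (tight_rank tQ0).
  have LL0 : (LX Q0 :&: LX (V :\: Q0))%VS = 0%VS.
    by rewrite supp_spaceI setDE setICA setICr setI0 supp_space0.
  have := cardsD V Q0; rewrite (setIidPr Q0V) (dimv_disjoint_sum LL0).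
  have := subset_leq_card Q0V.
  move: (\dim (LX V)) (\dim (LX Q0)) (\dim (LX (V :\: Q0))); clear; lia.
suff fib c : #|[set v in F | cl (al v) == c]| <= (connectivity G S T).+1.
  apply: leq_trans (fiber_bound fib) _; rewrite leq_mul2l /= card_mx card_Fp // mul1n.
  by rewrite leq_exp2l.
set C := [set v in F | _]; have [->|[v1 v1C]] := set_0Vmem C; first by rewrite cards0.
have CF : C \subset F by apply/subsetP => v; rewrite inE => /andP[].
have sameC v w : v \in C -> w \in C -> (al v - al w)%R \in Z.
  by rewrite !inE => /andP[vF /eqP vc] /andP[wF /eqP wc]; apply: sameP; rewrite ?vc.
case: (arg_minnP (fun v => #|least_pair G Q R v|) v1C) => v0 v0_in minv0.
have v0C : v0 \in C := v0_in.
have low := typed_separated badQ minQ0 t0 alP CF v0C minv0 sameC.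
have MF : (V :\: R) :\: Q0 \subset F :|: S :|: T.
  apply: subset_trans VF; apply/subsetP => u; rewrite !inE negb_or => /and3P[uQ0 -> ->].
  by rewrite !andbT; apply: contra uQ0 => /(subsetP QQ0).
have ct0 v : class_types a t C v != 0%R.
  rewrite /class_types; case: ifP => // vC.
  by case: (badQ v (subsetP CF v vC)).
have ctb v : v \in F -> class_types a t C v != b v.
  by move=> vF; rewrite /class_types; case: ifP => // _; case: (bad v vF).
have := typed_dim badS tS0 minS0 TV MF ct0 ctb.
have cC : #|C| = #|C :\ v0|.+1 by rewrite (cardsD1 v0) v0C.
move: low; set Gam := (_ :&: type_space _ _ _)%VS => low up.
(* Vanishing on [F] implies vanishing on [C :\ v0], so the two bounds on [Gam] leave [#|C :\ v0|] at
   most the connectivity of [(S, T)]. *)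
have le : \dim (Gam :&: LX (~: F)) <= \dim (Gam :&: LX (~: (C :\ v0))).
  apply: dimvS; apply: capvS; first exact: subvv.
  by apply: supp_spaceS; rewrite setCS; apply: subset_trans CF; apply: subsetDl.
rewrite cC; move: low up le.
move: (\dim Gam) (\dim (Gam :&: LX (~: F))) (\dim (Gam :&: LX (~: (C :\ v0)))); clear; lia.
Qed.
End Incompatible.

Theorem theorem1p2 (W : finType) (G : sgraph W) (Q R S T F : {set W})
    (k l : nat)
    (hQ : Q \subset vset G) (hR : R \subset vset G)
    (hS : S \subset vset G) (hT : T \subset vset G)
    (hQR : Q :&: R = set0) (hST : S :&: T = set0)
    (hk : connectivity G Q R = k) (hl : connectivity G S T = l)
    (hF : F = vset G :\: (Q :|: R :|: S :|: T))
    (hcard : (2 * l + 1) * 2 ^ (2 * k) <= #|F|) :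
  exists2 v : W, v \in F &
    at_least_two
      (connectivity (delete G v) Q R = k /\ connectivity (delete G v) S T = l)
      (connectivity (delete (local_compl G v) v) Q R = k /\
       connectivity (delete (local_compl G v) v) S T = l)
      (forall u : W, adj G v u ->
         connectivity (delete (pivot G u v) v) Q R = k /\
         connectivity (delete (pivot G u v) v) S T = l).
Proof.
pose ok H := (connectivity H Q R == k) && (connectivity H S T == l).
have okP H : reflect (connectivity H Q R = k /\ connectivity H S T = l) (ok H).
  by apply: (iffP andP) => [[/eqP-> /eqP->]|[-> ->]].
pose ok1 v := ok (delete G v); pose ok2 v := ok (delete (local_compl G v) v).
pose ok3 v := [forall u, adj G v u ==> ok (delete (pivot G u v) v)].
have ok3P v : ok3 v -> forall u, adj G v u ->
    connectivity (delete (pivot G u v) v) Q R = k /\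
    connectivity (delete (pivot G u v) v) S T = l.
  by move=> /forallP h u vu; apply/okP; have := h u; rewrite vu.
have [/exists_inP[v vF two]|none] :=
    boolP [exists v in F, [|| ok1 v && ok2 v, ok1 v && ok3 v | ok2 v && ok3 v]].
  exists v => //; case/or3P: two => /andP[].
  - by move=> /okP h1 /okP h2; left.
  - by move=> /okP h1 /ok3P h3; right; left.
  by move=> /okP h2 /ok3P h3; right; right.
have QVR : Q \subset vset G :\: R by rewrite subsetD hQ -setI_eq0 hQR eqxx.
have SVT : S \subset vset G :\: T by rewrite subsetD hS -setI_eq0 hST eqxx.
have inF v : v \in F -> [/\ v \in vset G, v \notin Q, v \notin R, v \notin S & v \notin T].
  by rewrite hF !inE !negb_or -!andbA => /and5P[].
(* Positivity of [l] is recorded on the [(S, T)] side for the final comparison. *)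
pose bad v t := bad_type G Q R v t \/ (bad_type G S T v t /\ 0 < l).
have badI v t H : v \in F -> t != 0%R -> is_minor_of_type G H v t -> ~~ ok H -> bad v t.
  move=> /inF[vV vQ vR vS vT] t0 mH; rewrite negb_and -hk -hl => /orP[] ne.
    by left; have [] := bad_type_minor t0 QVR vV vQ vR mH ne.
  by right; have := bad_type_minor t0 SVT vV vS vT mH ne; rewrite hl.
have bad1 v : v \in F -> ~~ ok1 v -> bad v (0, 1)%R.
  by move=> vF; apply: badI => //; exact: minor_delete.
have bad2 v : v \in F -> ~~ ok2 v -> bad v (1, 1)%R.
  by move=> vF; apply: badI => //; exact: minor_local_compl.
have bad3 v : v \in F -> ~~ ok3 v -> bad v (1, 0)%R.
  move=> vF /forallPn[u]; rewrite negb_imply => /andP[vu].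
  by apply: badI => //; exact: minor_pivot.
(* Each of [(Q, R)] and [(S, T)] has at most one bad type at [v], so two distinct ones are shared
   between them. *)
have split_bad v s t : bad v s -> bad v t -> s != t -> 0 < l /\
    exists ab : plane * plane,
      [/\ bad_type G Q R v ab.1, bad_type G S T v ab.2 & ab.1 != ab.2].
  case=> [bs|[bs l0]] [bt|[bt l0']] st.
  - by rewrite (bad_type_uniq bs bt) eqxx in st.
  - by split=> //; exists (s, t).
  - by split=> //; exists (t, s); split=> //=; rewrite eq_sym.
  by rewrite (bad_type_uniq bs bt) eqxx in st.
have badF v : v \in F -> 0 < l /\ exists ab : plane * plane,
      [/\ bad_type G Q R v ab.1, bad_type G S T v ab.2 & ab.1 != ab.2].
  move=> vF.
  have : ~~ [|| ok1 v && ok2 v, ok1 v && ok3 v | ok2 v && ok3 v] by exact: (exists_inPn none).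
  have := bad1 v vF; have := bad2 v vF; have := bad3 v vF.
  case: (ok1 v) (ok2 v) (ok3 v) => [] [] [] /= b3 b2 b1 // _.
  - by apply: split_bad (b2 isT) (b3 isT) _.
  - by apply: split_bad (b1 isT) (b3 isT) _.
  - by apply: split_bad (b1 isT) (b2 isT) _.
  by apply: split_bad (b1 isT) (b2 isT) _.
have F0 : 0 < #|F| by apply: leq_trans hcard; rewrite muln_gt0 addn1 expn_gt0.
have [v vF] := card_gt0P F0; have [l0 _] := badF v vF.
have [ab abP] : exists ab : W -> plane * plane, forall v, v \in F ->
    [/\ bad_type G Q R v (ab v).1, bad_type G S T v (ab v).2 & (ab v).1 != (ab v).2].
  apply: (@fin_all_exists W (fun=> (plane * plane)%type) (fun v ab => v \in F ->
    [/\ bad_type G Q R v ab.1, bad_type G S T v ab.2 & ab.1 != ab.2])) => w.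
  have [wF|_] := boolP (w \in F); last by exists (0, 0)%R.
  by have [_ [ab abP]] := badF w wF; exists ab.
have VF : vset G :\: (Q :|: R) \subset F :|: S :|: T.
  apply/subsetP => u; rewrite hF !inE !negb_or => /andP[/andP[-> ->] ->].
  by case: (u \in S); case: (u \in T).
have := @incompatible_bound _ G Q R S T F (fun v => (ab v).1) (fun v => (ab v).2)
  QVR SVT hT VF abP.
(* After cancelling the power there remains [2 * l + 1 <= l + 1], impossible for [l > 0]. *)
rewrite hk hl => /(leq_trans hcard); rewrite leq_mul2r expn_eq0 /=.
by move: l0; clear; lia.
Qed.
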